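(* Let $m\ge2$ and $i_1,\dots,i_N\in\{0,1\}$, and suppose \[\tilde T_{i_N}\circ\cdots\circ\tilde T_{i_1}\big((n_1,\dots,n_m)\times[k_1,\dots,k_m]\big)=(\bar n_1,\dots,\bar n_m)\times[\bar k_1,\dots,\bar k_m].\] Then \[\tilde T_{i_1}\circ\cdots\circ\tilde T_{i_N}\big((\bar k_1+\cdots+\bar k_m,\dots,\bar k_1)\times[\bar n_m,\bar n_{m-1}-\bar n_m,\dots,\bar n_1-\bar n_2]\big)=(k_1+\cdots+k_m,\dots,k_1)\times[n_m,n_{m-1}-n_m,\dots,n_1-n_2].\]
   Context: $(n_1,\dots,n_m)\times[k_1,\dots,k_m]$ denotes the partition with $k_i$ parts $n_i$; its conjugate is $(k_1+\cdots+k_m,k_1+\cdots+k_{m-1},\dots,k_1)\times[n_m,n_{m-1}-n_m,\dots,n_1-n_2]$. The extended slow-Triangle maps are $\tilde T_0((n_1,\dots,n_m)\times[k_1,\dots,k_m])=(n_2,\dots,n_m,n_1-n_2)\times[k_1+k_2,k_3,\dots,k_m,k_1]$ (applicable when $n_2+n_m>n_1$) and $\tilde T_1((n_1,\dots,n_m)\times[k_1,\dots,k_m])=(n_1-n_m,n_2,\dots,n_m)\times[k_1,\dots,k_{m-1},k_1+k_m]$ (applicable when $n_2+n_m<n_1$). *)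

(* Defs.v *)
From mathcomp Require Import all_boot.

Set Implicit Arguments.
Unset Strict Implicit.
Unset Printing Implicit Defensive.

(* The pair (n, k) of sequences of the same size m stands for
   (n_1, ..., n_m) x [k_1, ..., k_m]. *)
Definition mpart : Type := (seq nat * seq nat)%type.

Definition is_mpart (m : nat) (x : mpart) : bool :=
  [&& size x.1 == m, size x.2 == m,
      sorted gtn x.1, 0 \notin x.1 & 0 \notin x.2].

(* Partial maps: None means that the map is not applicable.  In the strict
   inequalities n_m is [last n2 n'], which is n2 itself when m = 2. *)
Definition slowT0 (x : mpart) : option mpart :=
  match x with
  | (n1 :: n2 :: n', k1 :: k2 :: k') =>
      if n1 < n2 + last n2 n' then
        Some (rcons (n2 :: n') (n1 - n2), rcons (k1 + k2 :: k') k1)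
      else None
  | _ => None
  end.

Definition slowT1 (x : mpart) : option mpart :=
  match x with
  | (n1 :: n2 :: n', k1 :: k2 :: k') =>
      if n2 + last n2 n' < n1 then
        Some (n1 - last n2 n' :: n2 :: n',
              rcons (belast k1 (k2 :: k')) (k1 + last k2 k'))
      else None
  | _ => None
  end.

(* The index set {0, 1} is bool, with 0 = false and 1 = true. *)
Definition slowT (i : bool) : mpart -> option mpart :=
  if i then slowT1 else slowT0.

(* slowT_comp [:: i_1; ...; i_N] is T_{i_1} o ... o T_{i_N}: the last index
   acts first. *)
Definition slowT_comp (s : seq bool) (x : mpart) : option mpart :=
  foldr (fun i y => obind (slowT i) y) (Some x) s.

(* Entries are indexed from 0.  Since nth returns 0 out of range, the first
   entry of the second component is n_m - 0 = n_m. *)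
Definition conj_mpart (x : mpart) : mpart :=
  let: (n, k) := x in
  let m := size n in
  (mkseq (fun j => \sum_(0 <= l < m - j) nth 0 k l) m,
   mkseq (fun j => nth 0 n (m - j.+1) - nth 0 n (m - j)) m).

(* Main.v *)
Require Import Defs.
From mathcomp Require Import all_boot zify.

(* Each map satisfies T_i (conj (T_i x)) = conj x, provided that the
   multiplicities of x are positive, a property which T_0 and T_1 preserve;
   composing N such identities reverses the order of the maps. *)

(** With two parts the tail is empty, and the default [f 1] is itself the last entry. *)
Lemma last_mkseq m (f : nat -> nat) :
  last (f 1) (mkseq (fun j => f j.+2) m) = f m.+1.
Proof. by case: m => [|m] //; rewrite (last_nth 0) size_mkseq /= nth_mkseq. Qed.

Lemma mkseqS {T} (f : nat -> T) m : mkseq f m.+1 = f 0 :: mkseq (fun j => f j.+1) m.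
Proof.
by rewrite /mkseq /= -(addn0 1) iotaDl -map_comp.
Qed.

Lemma mkseqSS {T} (f : nat -> T) m :
  mkseq f m.+2 = [:: f 0, f 1 & mkseq (fun j => f j.+2) m].
Proof. by rewrite !mkseqS. Qed.

Lemma eq_mkseq_lt (f g : nat -> nat) m :
  (forall j, j < m -> f j = g j) -> mkseq f m = mkseq g m.
Proof.
by move=> fg; apply/eq_in_map => j; rewrite mem_iota add0n => /fg.
Qed.

Lemma eq_mkseq_nth (s : seq nat) f m :
  size s = m -> (forall j, j < m -> nth 0 s j = f j) -> s = mkseq f m.
Proof. by move=> <- sf; rewrite -[LHS](mkseq_nth 0); apply: eq_mkseq_lt. Qed.

(** Writing the entries as functions of the index, with last index [m.+1], turns identities of lists
    into pointwise identities on [j < m.+2]. *)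
Definition T0_values m (f : nat -> nat) j :=
  if j == m.+1 then f 0 - f 1 else f j.+1.

Definition T0_mults m (g : nat -> nat) j :=
  if j == 0 then g 0 + g 1 else if j == m.+1 then g 0 else g j.+1.

Definition T1_values m (f : nat -> nat) j := if j == 0 then f 0 - f m.+1 else f j.

Definition T1_mults m (g : nat -> nat) j :=
  if j == m.+1 then g 0 + g m.+1 else g j.

Lemma slowT0_mkseq m f g :
  slowT0 (mkseq f m.+2, mkseq g m.+2) =
    if f 0 < f 1 + f m.+1
    then Some (mkseq (T0_values m f) m.+2, mkseq (T0_mults m g) m.+2) else None.
Proof.
rewrite (mkseqSS f) (mkseqSS g) /= last_mkseq.
case: ifP => // _; congr (Some (_, _)); apply: eq_mkseq_nth;
  rewrite /= ?size_rcons ?size_mkseq // => -[|j] // lt_j;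
  rewrite /T0_values /T0_mults /= nth_rcons size_mkseq ?eqSS.
  by case: ltngtP => // jm; rewrite ?nth_mkseq //; lia.
by case: ltngtP => // jm; rewrite ?nth_mkseq //; lia.
Qed.

Lemma slowT1_mkseq m f g :
  slowT1 (mkseq f m.+2, mkseq g m.+2) =
    if f 1 + f m.+1 < f 0
    then Some (mkseq (T1_values m f) m.+2, mkseq (T1_mults m g) m.+2) else None.
Proof.
rewrite (mkseqSS f) (mkseqSS g) /= !last_mkseq.
case: ifP => // _; congr (Some (_, _)); apply: eq_mkseq_nth;
  rewrite /= ?size_rcons /= ?size_belast ?size_mkseq // => j lt_j.
  by case: j lt_j => [|[|j]] lt_j //=; rewrite nth_mkseq.
rewrite -rcons_cons nth_rcons /= size_belast size_mkseq /T1_mults.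
case: ltngtP => [jm|?|_] //; last lia.
(* Before the last index, [belast] has the same entries as the whole list. *)
have := lastI (g 0) (g 1 :: mkseq (fun j => g j.+2) m).
rewrite -mkseqSS => /(congr1 (fun s => nth 0 s j)).
by rewrite nth_mkseq // nth_rcons /= size_belast size_mkseq jm.
Qed.

(** The test [j == 0] stands for the default of [nth] past the end: [f m] itself may be nonzero. *)
Lemma conj_mpart_mkseq m f g :
  conj_mpart (mkseq f m, mkseq g m) =
    (mkseq (fun j => \sum_(0 <= l < m - j) g l) m,
     mkseq (fun j => f (m - j.+1) - (if j == 0 then 0 else f (m - j))) m).
Proof.
rewrite /conj_mpart size_mkseq; congr pair; apply: eq_mkseq_lt => j lt_j.
  by apply: eq_big_nat => l /andP[_ lt_l]; rewrite nth_mkseq //; lia.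
rewrite nth_mkseq; last lia.
case: eqP => [->|/eqP j0]; first by rewrite nth_default // size_mkseq subn0.
by rewrite nth_mkseq //; lia.
Qed.

(** Partial sums of multiplicities are the parts of the conjugate. Merging [g 0] with [g 1] shifts
    them by one; only the total also sees the copy of [g 0] put at the end. *)
Lemma sum_T0_mults m g p : p <= m ->
  \sum_(0 <= l < p.+1) T0_mults m g l = \sum_(0 <= l < p.+2) g l.
Proof.
elim: p => [|p IHp] lt_p; first by rewrite !big_nat_recr //= !big_geq.
rewrite big_nat_recr //= IHp; last lia.
by rewrite [RHS]big_nat_recr //= /T0_mults /=; case: eqP => //; lia.
Qed.

Lemma sum_T0_mults_last m g :
  \sum_(0 <= l < m.+2) T0_mults m g l = \sum_(0 <= l < m.+2) g l + g 0.
Proof. by rewrite big_nat_recr //= sum_T0_mults // /T0_mults /= eqxx. Qed.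

Lemma sum_T1_mults m g p : p <= m.+1 ->
  \sum_(0 <= l < p) T1_mults m g l = \sum_(0 <= l < p) g l.
Proof.
move=> le_p; apply: eq_big_nat => l /andP[_ lt_l].
by rewrite /T1_mults; case: eqP => //; lia.
Qed.

Lemma sum_T1_mults_last m g :
  \sum_(0 <= l < m.+2) T1_mults m g l = \sum_(0 <= l < m.+2) g l + g 0.
Proof.
rewrite big_nat_recr //= sum_T1_mults // [in RHS]big_nat_recr //=.
by rewrite /T1_mults eqxx; lia.
Qed.

(** With [K] the sum of the [g j], the conjugate of [y] has first part [K + g 0], second part [K]
    and last part [g 0 + g 1]. So [slowT0] applies because [0 < g 1], and it appends the missing
    part [g 0]. *)
Lemma slowT0_conj m f g y : (forall j, j < m.+2 -> 0 < g j) ->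
  slowT0 (mkseq f m.+2, mkseq g m.+2) = Some y ->
  slowT0 (conj_mpart y) = Some (conj_mpart (mkseq f m.+2, mkseq g m.+2)).
Proof.
move=> g_gt0; rewrite slowT0_mkseq; case: ifP => // lt_f [<-].
rewrite !conj_mpart_mkseq slowT0_mkseq subn0 subSS subn0 subSn // subnn.
have g1 := g_gt0 1 isT.
rewrite sum_T0_mults_last !sum_T0_mults // ifT; last first.
  by rewrite ltn_add2l big_nat_recr //= big_nat1; lia.
congr (Some (_, _)); apply: eq_mkseq_lt => j lt_j.
  rewrite /T0_values; case: eqP => [->|/eqP jm].
    by rewrite subn0 subn1 subSnn big_nat1 sum_T0_mults_last sum_T0_mults // addKn.
  have [-> ->]: m.+2 - j.+1 = (m - j).+1 /\ m.+2 - j = (m - j).+2 by lia.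
  by rewrite sum_T0_mults // leq_subr.
rewrite /T0_mults /T0_values; case: (j =P 0) => [->|/eqP j0].
  (* By [lt_f], [f 0 - f 1 <= f m.+1], so the truncated difference is exact and the merged
     multiplicities add up to [f m.+1]. *)
  rewrite /= !subSS !subn0 !eqxx; case: eqP => //; lia.
case: (j =P m.+1) => [->|/eqP jm].
  by rewrite !subSS !subnn subSnn subn0 eqxx /= subn0.
do !case: eqP => [|_]; try lia.
by move=> *; congr (f _ - f _); lia.
Qed.

(** Here the first part is [K + g 0], the second [K - g m.+1] and the last [g 0]. So [slowT1]
    applies because [0 < g m.+1], and subtracting the last part restores [K]. *)
Lemma slowT1_conj m f g y : (forall j, j < m.+2 -> 0 < g j) ->
  slowT1 (mkseq f m.+2, mkseq g m.+2) = Some y ->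
  slowT1 (conj_mpart y) = Some (conj_mpart (mkseq f m.+2, mkseq g m.+2)).
Proof.
move=> g_gt0; rewrite slowT1_mkseq; case: ifP => // lt_f [<-].
rewrite !conj_mpart_mkseq slowT1_mkseq subn0 subSS subn0 subSn // subnn.
have gm := g_gt0 m.+1 (leqnn _).
rewrite sum_T1_mults_last !sum_T1_mults // ifT; last first.
  by rewrite big_nat1 [in ltnRHS]big_nat_recr //=; lia.
congr (Some (_, _)); apply: eq_mkseq_lt => j lt_j.
  rewrite /T1_values; case: eqP => [->|/eqP j0]; last first.
    by rewrite sum_T1_mults //; lia.
  by rewrite subn0 subSnn sum_T1_mults_last sum_T1_mults // big_nat1 addnK.
rewrite /T1_mults /T1_values; case: (j =P m.+1) => [->|/eqP jm].
  (* By [lt_f], adding [f m.+1] back to [f 0 - f m.+1 - f 1] gives [f 0 - f 1]. *)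
  by rewrite !subSS !subnn subSnn !subn0 /=; lia.
by do !case: eqP => [|_]; try lia.
Qed.

Lemma slowT_size i n k y :
  slowT i (n, k) = Some y -> size y.1 = size n /\ size y.2 = size k.
Proof.
case: i n k => -[|n1 [|n2 n']] [|k1 [|k2 k']] //=; case: ifP => // _ [<-] /=;
  by rewrite ?size_rcons ?size_belast.
Qed.

Lemma slowT_mults_gt0 i n k y :
  0 \notin k -> slowT i (n, k) = Some y -> 0 \notin y.2.
Proof.
case: i n k => -[|n1 [|n2 n']] [|k1 [|k2 k']] //= k_gt0; case: ifP => // _ [<-];
  move: k_gt0.
  (* [lastI] puts the old multiplicities in the [belast] form that [slowT1] returns. *)
  rewrite lastI /= !(mem_rcons, inE) !negb_or => /and3P[? ? ->].
  by rewrite andbT; lia.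
by rewrite /= !(mem_rcons, inE) !negb_or => /and3P[? ? ->]; rewrite andbT; lia.
Qed.

Lemma slowT_conj i n k y : size n = size k -> 0 \notin k ->
  slowT i (n, k) = Some y -> slowT i (conj_mpart y) = Some (conj_mpart (n, k)).
Proof.
case Dm: (size k) => [|[|m]] Dn k_gt0.
- by case: i n k Dm Dn {k_gt0} => -[|? ?] [].
- by case: i n k Dm Dn {k_gt0} => -[|? []] // [|? []].
have g_gt0 j : j < m.+2 -> 0 < nth 0 k j.
  rewrite -Dm => lt_j; rewrite lt0n; apply: contraNneq k_gt0 => <-.
  exact: mem_nth.
rewrite -(mkseq_nth 0 n) -(mkseq_nth 0 k) Dm Dn.
by case: i; [apply: slowT1_conj | apply: slowT0_conj].
Qed.

Lemma slowT_comp_rcons s i x :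
  slowT_comp (rcons s i) x = obind (slowT_comp s) (slowT i x).
Proof.
rewrite /slowT_comp foldr_rcons /=; case: (slowT i x) => //=.
by elim: s => //= j s ->.
Qed.

(** The head of [s] acts first on [(n, k)] and last on the conjugate of [y], so peeling it off
    leaves one use of [slowT_conj]. *)
Lemma slowT_comp_conj s n k y : size n = size k -> 0 \notin k ->
  slowT_comp (rev s) (n, k) = Some y ->
  slowT_comp s (conj_mpart y) = Some (conj_mpart (n, k)).
Proof.
elim: s n k => [|i s IHs] n k size_nk k_gt0; first by case=> <-.
rewrite rev_cons slowT_comp_rcons.
case Dz: (slowT i (n, k)) => [[n' k']|] // comp_y.
have [/= sn sk] := slowT_size _ _ _ _ Dz.
have k'_gt0 := slowT_mults_gt0 _ _ _ _ k_gt0 Dz.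
rewrite -[LHS]/(obind (slowT i) (slowT_comp s (conj_mpart y))).
by rewrite (IHs n' k') ?sn ?sk //; apply: slowT_conj Dz.
Qed.

Theorem theorem5p5 (m N : nat) (hm : 2 <= m) (i : N.-tuple bool)
    (n k nbar kbar : m.-tuple nat) (hnk : is_mpart m (tval n, tval k)) :
  slowT_comp (rev i) (tval n, tval k) = Some (tval nbar, tval kbar) ->
  slowT_comp i (conj_mpart (tval nbar, tval kbar))
    = Some (conj_mpart (tval n, tval k)).
Proof.
have /and5P[_ _ _ _ k_gt0] := hnk.
by apply: slowT_comp_conj; rewrite ?size_tuple.
Qed.
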